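(* Let $(\mathcal{A},\mathcal{B},\mathfrak{F},d,\tau)$ be a fusion bialgebra. The following statements: (1) the Schur product property holds on the dual, i.e. $x*_{\mathcal{B}}y\ge0$ for all $x,y\ge0$ in $\mathcal{B}$; (2) $\|x*_{\mathcal{B}}y\|_{1,\mathcal{B}}=\|x\|_{1,\mathcal{B}}\|y\|_{1,\mathcal{B}}$ for any $x\ge0$, $y\ge0$ in $\mathcal{B}$; (3) $\|x*_{\mathcal{B}}y\|_{1,\mathcal{B}}\le\|x\|_{1,\mathcal{B}}\|y\|_{1,\mathcal{B}}$ for any $x,y$ in $\mathcal{B}$; (4) $\|x*_{\mathcal{B}}y\|_{\infty,\mathcal{B}}\le\|x\|_{1,\mathcal{B}}\|y\|_{\infty,\mathcal{B}}$ for any $x,y$ in $\mathcal{B}$; satisfy $(4)\Leftrightarrow(3)\Rightarrow(1)\Leftrightarrow(2)$.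
   Context: Fusion bialgebra: let $\mathcal{A}$ and $\mathcal{B}$ be finite-dimensional $C^*$-algebras with faithful (positive) traces $d$ and $\tau$ respectively, with $\mathcal{A}$ commutative. The multiplication and involution of $\mathcal{A}$ are written $\diamond$ and $\#$, those of $\mathcal{B}$ are written $xy$ and $*$. Let $\mathfrak{F}:\mathcal{A}\to\mathcal{B}$ be a unitary transformation preserving 2-norms, i.e. a linear bijection with $\tau(\mathfrak{F}(x)^*\mathfrak{F}(y))=d(x^\#\diamond y)$ for all $x,y\in\mathcal{A}$. The quintuple $(\mathcal{A},\mathcal{B},\mathfrak{F},d,\tau)$ is a fusion bialgebra if: (1) for $x,y\ge0$ in $\mathcal{A}$, $x*y:=\mathfrak{F}^{-1}(\mathfrak{F}(x)\mathfrak{F}(y))\ge0$ in $\mathcal{A}$; (2) $J(x):=\mathfrak{F}^{-1}(\mathfrak{F}(x)^* )$ is an anti-linear $*$-isomorphism on $\mathcal{A}$; (3) $\mathfrak{F}^{-1}(1_{\mathcal{B}})$ is a positive multiple of a minimal projection in $\mathcal{A}$. Convolution on $\mathcal{B}$: $x*_{\mathcal{B}}y:=\big(\mathfrak{F}(\mathfrak{F}^{-1}(y^* )\diamond\mathfrak{F}^{-1}(x^* ))\big)^*$. Norms: $\|x\|_{1,\mathcal{B}}=\tau((x^*x)^{1/2})$ and $\|x\|_{\infty,\mathcal{B}}$ is the $C^*$-norm of $\mathcal{B}$.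
   Formalization: The traces are assumed normalized so that d(F^{-1}(1_B)) = 1; without this the claim fails, e.g. for A = B = C, F = id, d = τ = k·id with k ≠ 1, where (1) holds but (2) does not. *)

(* Defs.v *)
From HB Require Import structures.
From mathcomp Require Import all_boot all_order all_algebra falgebra.
From mathcomp Require Import classical_sets reals complex.

Set Implicit Arguments.
Unset Strict Implicit.
Unset Printing Implicit Defensive.

Import Order.TTheory GRing.Theory Num.Theory.

Local Open Scope ring_scope.

(* In finite dimension completeness of the norm is automatic. [Re `|a|] is the
   modulus of [a] as an element of [R], since the norm of [R[i]] takes values
   in [R[i]]. *)
HB.mixin Record isCStar (R : realType) A & Falgebra R[i] A := {
  star : A -> A;
  starK : involutive star;
  starD : {morph star : x y / x + y};
  starZ : forall (a : R[i]) (x : A), star (a *: x) = a^* *: star x;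
  starM : forall x y : A, star (x * y) = star y * star x;
  cnorm : A -> R;
  cnorm_eq0 : forall x : A, cnorm x = 0 -> x = 0;
  cnormD : forall x y : A, cnorm (x + y) <= cnorm x + cnorm y;
  cnormZ : forall (a : R[i]) (x : A), cnorm (a *: x) = complex.Re `|a| * cnorm x;
  cnormM : forall x y : A, cnorm (x * y) <= cnorm x * cnorm y;
  cnorm_cstar : forall x : A, cnorm (star x * x) = cnorm x ^+ 2
}.

(* Every nonzero finite-dimensional C*-algebra is unital, hence an [falgType];
   the zero algebra is ruled out in a fusion bialgebra by the existence of a
   minimal projection. *)
#[short(type="fdCStarType")]
HB.structure Definition FdCStar (R : realType) :=
  { A of Falgebra R[i] A & isCStar R A }.

Section CStar.
Variables (R : realType) (A : fdCStarType R).
Implicit Types (x y p q : A) (t : {scalar A}).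

Definition cpos x : Prop := exists y, x = star y * y.

Definition is_proj p : Prop := p * p = p /\ star p = p.

Definition minimal_proj p : Prop :=
  [/\ is_proj p, p != 0 &
      forall q, is_proj q -> cpos (p - q) -> q = 0 \/ q = p].

Definition faithful_trace t : Prop :=
  [/\ forall x y, t (x * y) = t (y * x),
      forall x, 0 <= t (star x * x) &
      forall x, t (star x * x) = 0 -> x = 0].

(* The positive square root. For positive [x] it exists and is unique, so
   the default value [0] of [xget] plays no role. *)
Definition csqrt x : A := xget 0 [set y | cpos y /\ y * y = x]%classic.

(* For a positive trace [t], the value under [Re] is real and nonnegative. *)
Definition norm1 t x : R := complex.Re (t (csqrt (star x * x))).

End CStar.

Section Fusion.
Variables (R : realType) (A B : fdCStarType R).
Variable F : 'Hom(A, B).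

(* [(F^-1)%VF] is the library's inverse of a linear map; it is the two-sided
   inverse as soon as [F] is bijective. *)
Definition conv (x y : A) : A := (F^-1)%VF (F x * F y).

Definition modconj (x : A) : A := (F^-1)%VF (star (F x)).

Definition dual_conv (x y : B) : B :=
  star (F ((F^-1)%VF (star y) * (F^-1)%VF (star x))).

(* The multiplications of [A] and [B] are both written [*], and both
   involutions [star]. These axioms are invariant under rescaling [d] and [tau]
   by a common positive factor with [F] fixed, so they do not determine the
   value [d ((F^-1)%VF 1)]; it is 1 in the usual normalization, in which
   [(F^-1)%VF 1] is a minimal projection of trace 1. *)
Record fusion_bialgebra (d : {scalar A}) (tau : {scalar B}) : Prop := {
  fb_mulC : forall x y : A, x * y = y * x;
  fb_d : faithful_trace d;
  fb_tau : faithful_trace tau;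
  fb_bij : bijective F;
  fb_unitary : forall x y : A, tau (star (F x) * F y) = d (star x * y);
  fb_schur : forall x y : A, cpos x -> cpos y -> cpos (conv x y);
  fb_modconj_bij : bijective modconj;
  fb_modconjD : {morph modconj : x y / x + y};
  fb_modconjZ : forall (a : R[i]) (x : A),
    modconj (a *: x) = a^* *: modconj x;
  fb_modconjM : {morph modconj : x y / x * y};
  fb_modconjJ : {morph modconj : x / star x};
  fb_jones : exists (c : R[i]) (p : A),
    [/\ 0 < c, minimal_proj p & (F^-1)%VF 1 = c *: p]
}.

End Fusion.

(* Main.v *)
Require Import Defs.
From HB Require Import structures.
From mathcomp Require Import all_boot all_order all_algebra falgebra.
From mathcomp Require Import boolp classical_sets reals complex lra.

(* Write a = F^-1 x, b = F^-1 y; then the dual convolution of x and y is F (a b).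
   Since F^-1 1 is a multiple of a minimal projection of the commutative algebra
   A, the functional tau o F is a character of A, so tau is multiplicative for
   the dual convolution. As the 1-norm dominates Re tau, with equality exactly at
   the positive elements, this gives (1) <-> (2) and (3) -> (1).
   The Schur product axiom makes sigma : x |-> F (star (F^-1 x)) an antilinear
   star-automorphism of B, hence an isometry of the 1-norm, and convolution by
   sigma x is adjoint to convolution by x. Then (3) <-> (4) follows from the
   duality of the 1-norm and the C*-norm. Square roots, moduli and spectral
   projections come from polynomial interpolation on the spectrum. *)

Set Implicit Arguments.
Unset Strict Implicit.
Unset Printing Implicit Defensive.

Import Order.TTheory GRing.Theory Num.Theory.

Local Open Scope ring_scope.

(** * Finite-dimensional C*-algebras *)

Section StarAlgebra.
Variables (R : realType) (A : fdCStarType R).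
Implicit Types (x y h p q : A) (a b : R[i]).

Lemma star0 : star 0 = 0 :> A.
Proof. by apply: (addrI (star 0)); rewrite -starD !addr0. Qed.

Lemma starN x : star (- x) = - star x.
Proof. by apply: (addrI (star x)); rewrite -starD !subrr star0. Qed.

Lemma starB x y : star (x - y) = star x - star y.
Proof. by rewrite starD starN. Qed.

Lemma star1 : star 1 = 1 :> A.
Proof. by have := starM (star 1) (1 : A); rewrite !mulr1 !starK mulr1. Qed.

Lemma starZ_real a x : 0 <= a -> star (a *: x) = a *: star x.
Proof. by move=> a0; rewrite starZ geC0_conj. Qed.

Lemma horner_alg_comm h (p : {poly R[i]}) :
  h * horner_alg h p = horner_alg h p * h.
Proof.
rewrite -[X in X * _]horner_algX -[X in _ = _ * X]horner_algX -!rmorphM.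
by rewrite mulrC.
Qed.

Lemma star_horner h (p : {poly R[i]}) :
  star (horner_alg h p) = horner_alg (star h) (map_poly Num.conj p).
Proof.
elim/poly_ind: p => [|p c IHp]; first by rewrite !raddf0 star0.
have -> : map_poly Num.conj (p * 'X + c%:P)
    = map_poly Num.conj p * 'X + (c^*)%:P.
  by rewrite rmorphD rmorphM /= map_polyX map_polyC.
rewrite !rmorphD !rmorphM /= !horner_algX !horner_algC starD starM IHp starZ.
by rewrite star1 horner_alg_comm.
Qed.

Lemma cpos_star x : cpos x -> star x = x.
Proof. by case=> y ->; rewrite starM starK. Qed.

Lemma cposZ a x : 0 <= a -> cpos x -> cpos (a *: x).
Proof.
move=> a0 [y ->]; exists (sqrtC a *: y).
rewrite starZ_real ?sqrtC_ge0// -scalerAl -scalerAr scalerA -expr2.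
by rewrite sqrtCK.
Qed.

Lemma cnorm0 : cnorm (0 : A) = 0.
Proof. by rewrite -(scale0r (0 : A)) cnormZ normr0 mul0r. Qed.

Lemma cnormN x : cnorm (- x) = cnorm x.
Proof. by rewrite -scaleN1r cnormZ normrN1 mul1r. Qed.

Lemma cnorm_ge0 x : 0 <= cnorm x.
Proof.
have := cnormD x (- x); rewrite subrr cnorm0 cnormN -mulr2n.
by rewrite pmulrn_lge0.
Qed.

Lemma cnorm_gt0 x : x != 0 -> 0 < cnorm x.
Proof.
move=> x0; rewrite lt_def cnorm_ge0 andbT.
by apply: contra_neq x0 => /cnorm_eq0.
Qed.

Lemma cnorm_star x : cnorm (star x) = cnorm x.
Proof.
have le y : cnorm y <= cnorm (star y).
  have [->|/cnorm_gt0 y0] := eqVneq y 0; first by rewrite star0.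
  by rewrite -(ler_pM2r y0) -expr2 -cnorm_cstar cnormM.
by apply/eqP; rewrite eq_le -{2}[x]starK !le.
Qed.

Lemma proj_cnorm_le1 q : is_proj q -> cnorm q <= 1.
Proof.
case=> qq sq; have := cnorm_cstar q; rewrite sq qq => e.
have [->|/cnorm_gt0 q0] := eqVneq q 0; first by rewrite cnorm0.
by rewrite -(ler_pM2r q0) mul1r -expr2 -e.
Qed.

(* Polarisation: [4 x = (x + 1)^2 - (x - 1)^2] for selfadjoint [x]. *)
Lemma cpos_span (P : A -> Prop) :
  (forall x y, P x -> P y -> P (x + y)) -> (forall a x, P x -> P (a *: x)) ->
  (forall x, cpos x -> P x) -> forall x, P x.
Proof.
move=> PD PZ Pp.
have PB x y : P x -> P y -> P (x - y).
  by move=> px py; apply: PD => //; rewrite -scaleN1r; apply: PZ.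
have Ps x : star x = x -> P x.
  move=> sx; have -> : x = 4%:R^-1 *: ((x + 1) * (x + 1) - (x - 1) * (x - 1)).
    have -> : (x + 1) * (x + 1) - (x - 1) * (x - 1) = x *+ 4.
      rewrite -!expr2 sqrrD1 sqrrB1 opprD addrACA subrr addr0 opprB addrC addrA.
      by rewrite subrK -mulrnDr.
    by rewrite -[x *+ 4]scaler_nat scalerA mulVf ?scale1r// pnatr_eq0.
  apply/PZ/PB; apply: Pp.
    by exists (x + 1); rewrite starD sx star1.
  by exists (x - 1); rewrite starB sx star1.
move=> x; have -> : x = 2%:R^-1 *: (x + star x)
     + (- 'i / 2%:R) *: ('i *: (x - star x)).
  rewrite scalerA mulrAC mulNr -expr2 sqrCi opprK mul1r -scalerDr.
  rewrite addrACA subrr addr0 -mulr2n -[x *+ 2]scaler_nat.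
  by rewrite scalerA mulVf ?scale1r// pnatr_eq0.
apply: PD; apply/PZ/Ps; first by rewrite starD starK addrC.
by rewrite starZ conjCi starB starK scaleNr -scalerN opprB.
Qed.

End StarAlgebra.

(** * Polynomial interpolation on a finite set *)

Section Interpolation.
Variable K : fieldType.

(** Newton's scheme: a new node [a] is handled by adding a multiple of the product of the
    ['X - l%:P] over the old nodes, which vanishes at those nodes and not at [a]. *)
Lemma interpolation (s : seq K) (f : K -> K) :
  exists p : {poly K}, forall l, l \in s -> p.[l] = f l.
Proof.
elim: s => [|a s [p Hp]]; first by exists 0.
case as_ : (a \in s).
  by exists p => l; rewrite inE => /predU1P[->|/Hp//]; apply: Hp.
pose q := \prod_(l <- s) ('X - l%:P).
exists (p + ((f a - p.[a]) / q.[a]) *: q) => l.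
rewrite !hornerE; have [->|] := eqVneq l a; rewrite inE.
  rewrite divfK ?subrKC//.
  by rewrite -[_ == 0]/(root q a) root_prod_XsubC as_.
move/negPf => -> /= ls; rewrite Hp//.
by have := root_prod_XsubC s l; rewrite ls => /rootP ->; rewrite mulr0 addr0.
Qed.

End Interpolation.

(** * Functional calculus *)

Section Spectrum.
Variables (R : realType) (A : fdCStarType R) (t : {scalar A}).
Hypothesis ft : faithful_trace t.
Local Notation C := (R[i]).
Implicit Types (x y z h v p q : A) (a b l : C) (f g : C -> C) (s : seq C).

Lemma traceC x y : t (x * y) = t (y * x).
Proof. by case: ft. Qed.

Lemma trace_ge0 x : cpos x -> 0 <= t x.
Proof. by case: ft => _ H _ [y ->]. Qed.

Lemma trace_eq0 x : t (star x * x) = 0 -> x = 0.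
Proof. by case: ft => _ _; apply. Qed.

Lemma trace_gt0 x : x != 0 -> 0 < t (star x * x).
Proof.
move=> x0; rewrite lt_def trace_ge0 ?andbT; last by exists x.
by apply: contra_neq x0 => /trace_eq0.
Qed.

Lemma trace_star x : t (star x) = (t x)^*.
Proof.
elim/cpos_span : x => [x y IHx IHy|a x IHx|x px].
- by rewrite starD !linearD /= IHx IHy rmorphD.
- by rewrite starZ !linearZ /= IHx rmorphM.
- by rewrite cpos_star// geC0_conj ?trace_ge0.
Qed.

(** * Eigenvalues of left multiplication and the spectrum *)

Definition eigenval h l : Prop := exists2 v, v != 0 & h * v = l *: v.

Lemma eigenval_real h l : star h = h -> eigenval h l -> l \is Num.real.
Proof.
move=> sh [v v0 hv]; have e : t (star v * h * v) = l * t (star v * v).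
  by rewrite -mulrA hv -scalerAr linearZ.
have tv := trace_gt0 v0.
have : (t (star v * h * v))^* = t (star v * h * v).
  by rewrite -trace_star !starM starK sh mulrA.
rewrite e rmorphM /= [(t _)^*]geC0_conj ?ltW// => /(mulIf (lt0r_neq0 tv)) lr.
by apply/CrealP.
Qed.

Lemma eigenval_ge0 h l : cpos h -> eigenval h l -> 0 <= l.
Proof.
move=> [y ->] [v v0 hv]; rewrite -(pmulr_lge0 _ (trace_gt0 v0)).
suff -> : l * t (star v * v) = t (star (y * v) * (y * v)).
  by apply: trace_ge0; exists (y * v).
have -> : star (y * v) * (y * v) = star v * (star y * y * v).
  by rewrite starM !mulrA.
by rewrite hv -scalerAr linearZ.
Qed.

Lemma eigenval_norm h l : eigenval h l -> complex.Re `|l| <= cnorm h.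
Proof.
move=> [v /cnorm_gt0 v0 hv].
by rewrite -(ler_pM2r v0) -cnormZ -hv cnormM.
Qed.

(** The first [\dim A + 1] powers of [h] are linearly dependent, and the resulting nonzero
    polynomial splits because [R[i]] is algebraically closed. *)
Lemma annihilator_ex h :
  exists s, horner_alg h (\prod_(l <- s) ('X - l%:P)) = 0.
Proof.
pose n := (\dim {:A}).+1.
have [k [k0 kn0]] : exists k : 'I_n -> C,
    \sum_(i < n) k i *: h ^+ i = 0 /\ exists i, k i != 0.
  apply: contrapT => H.
  pose X := [tuple h ^+ i | i < n].
  have : free X.
    apply/freeP => k k0 i; apply: contrapT => /eqP ki; apply: H; exists k.
    split; last by exists i.
    rewrite -[RHS]k0; apply: eq_bigr => j _.
    by rewrite -tnth_nth tnth_mktuple.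
  rewrite /free size_tuple => /eqP dX.
  by have := dimvS (subvf <<X>>); rewrite dX ltnn.
case: kn0 => i ki; pose p := \poly_(j < n) k (inord j).
have p0 : p != 0.
  apply: contra_neq ki => p0; have : p`_i = 0 by rewrite p0 coef0.
  by rewrite coef_poly ltn_ord inord_val.
have [r pr] := closed_field_poly_normal p; exists r.
have : horner_alg h p = 0.
  rewrite /p poly_def linear_sum -[RHS]k0; apply: eq_bigr => j _.
  by rewrite linearZ /= inord_val rmorphXn /= horner_algX mulr_algl.
rewrite {1}pr linearZ /= mulr_algl => /eqP.
by rewrite scaler_eq0 lead_coef_eq0 (negPf p0) => /eqP.
Qed.

(* In a shortest annihilating product of factors [h - l] every [l] is an
   eigenvalue, and no factor is repeated since [(h - l)^2 y = 0] forces
   [(h - l) y = 0] when [h - l] is selfadjoint. *)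
Lemma spectrum_ex h : star h = h -> exists s,
  [/\ uniq s, horner_alg h (\prod_(l <- s) ('X - l%:P)) = 0 &
      forall l, l \in s -> eigenval h l].
Proof.
move=> sh; pose P s := horner_alg h (\prod_(l <- s) ('X - l%:P)).
have Pcons l s : P (l :: s) = (h - l%:A) * P s.
  by rewrite /P big_cons rmorphM rmorphB /= horner_algX horner_algC.
have Pperm s s' : perm_eq s s' -> P s = P s'.
  by move=> ss'; rewrite /P (perm_big _ ss').
have ex : exists n, `[< exists s, size s = n /\ P s = 0 >].
  have [s Ps] := annihilator_ex h; exists (size s).
  by apply/asboolP; exists s.
case: (ex_minnP ex) => n /asboolP[s [sn Ps]] nmin.
have Pmin s' : (size s' < n)%N -> P s' != 0.
  move=> s'n; apply/eqP => Ps'; move: s'n; rewrite ltnNge nmin//.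
  by apply/asboolP; exists s'.
have ev l : l \in s -> eigenval h l.
  (* The product of the remaining factors is nonzero by minimality and is killed by [h - l], so it
     is an eigenvector. *)
  move=> ls; have rs := perm_to_rem ls; exists (P (rem l s)).
    by apply: Pmin; rewrite -sn (perm_size rs).
  apply/eqP; rewrite -subr_eq0 -mulr_algl -mulrBl -Pcons.
  by rewrite -(Pperm _ _ rs) Ps.
exists s; split => //.
apply: count_mem_uniq => l.
case ls : (l \in s); last by apply/count_memPn/negbT.
have rs := perm_to_rem ls.
rewrite (permP rs) /= eqxx; congr (1 + _)%N; apply/count_memPn/negP => lr.
have rr := perm_to_rem lr; set s' := rem l (rem l s) in rr.
have /eqP[] : P (l :: s') != 0.
  by apply: Pmin; rewrite -sn (perm_size rs) -(perm_size rr) ltnSn.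
rewrite Pcons; apply: trace_eq0; set x := h - l%:A.
have sx : star x = x.
  by rewrite starB starZ star1 sh conj_Creal// (eigenval_real sh (ev _ ls)).
have : x * (x * P s') = 0.
  by rewrite -Pcons -(Pperm _ _ rr) -Pcons -(Pperm _ _ rs).
by rewrite starM sx -mulrA => ->; rewrite mulr0 linear0.
Qed.

(* The default [::] can be reached only when [h] is not selfadjoint. *)
Definition spec h : seq C := xget [::] [set s | [/\ uniq s,
  horner_alg h (\prod_(l <- s) ('X - l%:P)) = 0 &
  forall l, l \in s -> eigenval h l]]%classic.

(** Since the spectrum is finite, an interpolating polynomial exists for every function [f], without
    any continuity. For selfadjoint [h] the choice of polynomial is immaterial by [fcalc_horner]. *)
Definition fcalc h f : A :=
  horner_alg h (xget 0 [set p | forall l, l \in spec h -> p.[l] = f l]%classic).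

Section Selfadjoint.
Variable h : A.
Hypothesis sh : star h = h.

Lemma specP : [/\ uniq (spec h),
  horner_alg h (\prod_(l <- spec h) ('X - l%:P)) = 0 &
  forall l, l \in spec h -> eigenval h l].
Proof. exact: (xgetPex _ (spectrum_ex sh)). Qed.

Lemma spec_eigenval l : l \in spec h -> eigenval h l.
Proof. by case: specP => _ _; apply. Qed.

Lemma spec_real l : l \in spec h -> l^* = l.
Proof. by move/spec_eigenval/(eigenval_real sh)/conj_Creal. Qed.

(** Two polynomials that agree on the spectrum differ by a multiple of the product of the
    ['X - l%:P], which annihilates [h]. *)
Lemma fcalc_horner f (p : {poly C}) :
  (forall l, l \in spec h -> p.[l] = f l) -> fcalc h f = horner_alg h p.
Proof.
move=> Hp; rewrite /fcalc; set q := xget _ _.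
have Hq : forall l, l \in spec h -> q.[l] = f l.
  by apply: (xgetPex 0 (interpolation _ _)).
have [us s0 _] := specP; apply/eqP; rewrite -subr_eq0 -rmorphB.
have /dvdpP[r ->] : \prod_(l <- spec h) ('X - l%:P) %| q - p.
  apply: uniq_roots_dvdp; last by rewrite uniq_rootsE.
  by apply/allP => l ls; rewrite /root !hornerE Hq// Hp// subrr.
by rewrite rmorphM /= s0 mulr0.
Qed.

Lemma fcalcP f : exists2 p : {poly C}, fcalc h f = horner_alg h p &
  forall l, l \in spec h -> p.[l] = f l.
Proof.
by have [p Hp] := interpolation (spec h) f; exists p => //; apply: fcalc_horner.
Qed.

Lemma eq_fcalc f g : {in spec h, f =1 g} -> fcalc h f = fcalc h g.
Proof.
move=> fg; have [p -> Hp] := fcalcP g; apply: fcalc_horner => l ls.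
by rewrite Hp// fg.
Qed.

Lemma fcalcD f g : fcalc h f + fcalc h g = fcalc h (fun l => f l + g l).
Proof.
have [p -> Hp] := fcalcP f; have [q -> Hq] := fcalcP g; rewrite -rmorphD.
by apply/esym/fcalc_horner => l ls; rewrite !hornerE Hp// Hq.
Qed.

Lemma fcalcM f g : fcalc h f * fcalc h g = fcalc h (fun l => f l * g l).
Proof.
have [p -> Hp] := fcalcP f; have [q -> Hq] := fcalcP g; rewrite -rmorphM.
by apply/esym/fcalc_horner => l ls; rewrite !hornerE Hp// Hq.
Qed.

Lemma fcalc_cst a : fcalc h (fun=> a) = a%:A.
Proof.
by rewrite -(horner_algC h); apply: fcalc_horner => l _; rewrite hornerC.
Qed.

Lemma fcalc_sum (s : seq C) (G : C -> C -> C) :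
  \sum_(l <- s) fcalc h (G l) = fcalc h (fun m => \sum_(l <- s) G l m).
Proof.
elim: s => [|a s IHs].
  rewrite big_nil (@fcalc_horner _ 0) ?linear0// => m _.
  by rewrite horner0 big_nil.
by rewrite big_cons IHs fcalcD; apply: eq_fcalc => m _; rewrite big_cons.
Qed.

Lemma fcalc_delta_sum :
  \sum_(l <- spec h) fcalc h (fun m => (m == l)%:R) = 1.
Proof.
rewrite fcalc_sum -[RHS]scale1r -fcalc_cst; apply: eq_fcalc => m ms.
have [us _ _] := specP; rewrite (bigD1_seq m)//= eqxx big1 ?addr0// => l.
by rewrite eq_sym => /negPf ->.
Qed.

Lemma fcalc_id : fcalc h id = h.
Proof.
by rewrite -[RHS](horner_algX h); apply: fcalc_horner => l _; rewrite hornerX.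
Qed.

Lemma fcalc_star f : star (fcalc h f) = fcalc h (fun l => (f l)^* ).
Proof.
have [p -> Hp] := fcalcP f; rewrite star_horner sh.
apply/esym/fcalc_horner => l ls.
by rewrite -[in LHS](spec_real ls) horner_map /= Hp.
Qed.

Lemma fcalc_star_real f :
  (forall l, l \in spec h -> f l \is Num.real) -> star (fcalc h f) = fcalc h f.
Proof.
by move=> fr; rewrite fcalc_star; apply: eq_fcalc => l /fr /conj_Creal.
Qed.

Lemma fcalc_cpos f : (forall l, l \in spec h -> 0 <= f l) -> cpos (fcalc h f).
Proof.
move=> f0; exists (fcalc h (fun l => sqrtC (f l))).
rewrite fcalc_star fcalcM; apply: eq_fcalc => l ls.
by rewrite geC0_conj ?sqrtC_ge0 ?f0// -expr2 sqrtCK.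
Qed.

(** An eigenvector of [h] for [l] is an eigenvector of every polynomial [q] in [h], for the value
    [q.[l]]. *)
Lemma fcalc_eq0 f l : fcalc h f = 0 -> l \in spec h -> f l = 0.
Proof.
have [p -> Hp] := fcalcP f; move=> p0 ls; have [v v0 hv] := spec_eigenval ls.
have e (q : {poly C}) : horner_alg h q * v = q.[l] *: v.
  elim/poly_ind: q => [|q c IHq].
    by rewrite linear0 mul0r horner0 scale0r.
  rewrite rmorphD rmorphM /= horner_algX horner_algC mulrDl -mulrA hv.
  by rewrite -scalerAr IHq scalerA mulr_algl -scalerDl !hornerE mulrC.
have /eqP := e p; rewrite p0 mul0r eq_sym scaler_eq0 (negPf v0) orbF.
by rewrite Hp// => /eqP.
Qed.

End Selfadjoint.

Lemma spec_ge0 h l : cpos h -> l \in spec h -> 0 <= l.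
Proof.
by move=> hp /(spec_eigenval (cpos_star hp)); apply: eigenval_ge0.
Qed.

(* Both roots are the same polynomial in their common square. *)
Lemma cpos_sqr_inj y z : cpos y -> cpos z -> y * y = z * z -> y = z.
Proof.
have u h x : cpos x -> x * x = h -> forall q : {poly C},
    (forall m, m \in spec x -> q.[m ^+ 2] = m) -> x = horner_alg h q.
  move=> xp xh q Hq; have sx := cpos_star xp.
  rewrite -[LHS]fcalc_id// (@fcalc_horner _ sx _ (q \Po 'X^2)).
    rewrite -xh; elim/poly_ind: q {Hq} => [|q c IHq].
      by rewrite comp_poly0 !linear0.
    rewrite comp_polyD comp_polyM comp_polyX comp_polyC !rmorphD !rmorphM /=.
    by rewrite !horner_algC IHq !horner_algX.
  by move=> m ms; rewrite horner_comp hornerXn Hq.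
move=> yp zp yz.
(* A single [q] inverts squaring on both spectra, which are nonnegative; hence [y] and [z] are both
   [q] evaluated at the common square. *)
have [q Hq] := interpolation [seq m ^+ 2 | m <- spec y ++ spec z] sqrtC.
have H m : m \in spec y ++ spec z -> q.[m ^+ 2] = m.
  move=> ms; rewrite Hq; last exact: (map_f (fun m : C => m ^+ 2) ms).
  apply: sqrCK; move: ms; rewrite mem_cat.
  by case/orP => [/(spec_ge0 yp)|/(spec_ge0 zp)].
transitivity (horner_alg (z * z) q); [|symmetry].
  by apply: u => // m ms; apply: H; rewrite mem_cat ms.
by apply: u => // m ms; apply: H; rewrite mem_cat ms orbT.
Qed.

Lemma csqrt_unique y h : cpos y -> y * y = h -> csqrt h = y.
Proof.
move=> yp yh; apply: xget_subset1 => // x z [xp xh] [zp zh].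
by apply: cpos_sqr_inj => //; rewrite xh zh.
Qed.

Lemma fcalc_sqrtP h : cpos h ->
  cpos (fcalc h sqrtC) /\ fcalc h sqrtC * fcalc h sqrtC = h.
Proof.
move=> hp; have sh := cpos_star hp; split.
  by apply: fcalc_cpos => // l /(spec_ge0 hp); rewrite sqrtC_ge0.
rewrite fcalcM// -[RHS]fcalc_id//; apply: eq_fcalc => // l _.
by rewrite -expr2 sqrtCK.
Qed.

Lemma csqrt_fcalc h : cpos h -> csqrt h = fcalc h sqrtC.
Proof. by move=> /fcalc_sqrtP[sp ss]; apply: csqrt_unique. Qed.

Lemma csqrtP h : cpos h -> cpos (csqrt h) /\ csqrt h * csqrt h = h.
Proof. by move=> hp; rewrite csqrt_fcalc//; apply: fcalc_sqrtP. Qed.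

Lemma cpos_starM x : cpos (star x * x).
Proof. by exists x. Qed.

Lemma ge0_RRe a : 0 <= a -> (complex.Re a)%:C%C = a.
Proof. by move=> a0; rewrite RRe_real ?ger0_real. Qed.

Lemma Re_realM (k : R) a : complex.Re (k%:C%C * a) = k * complex.Re a.
Proof. by case: a => x y /=; rewrite mul0r subr0. Qed.

Lemma Re_conj a : complex.Re a^* = complex.Re a.
Proof. by case: a. Qed.

(** * The 1-norm *)

Lemma norm1_cpos x : cpos x -> t x = (norm1 t x)%:C%C.
Proof.
move=> xp; rewrite /norm1 (cpos_star xp) (csqrt_unique xp erefl).
by rewrite ge0_RRe ?trace_ge0.
Qed.

(* [r] is the square root of the modulus of [z], so that [t (r * r)] is the
   1-norm of [z]. *)
Lemma polar z : exists u r, [/\ star r = r, u * (r * r) = z, star u * z = r * r,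
  cnorm u <= 1 & t (r * r) = (norm1 t z)%:C%C].
Proof.
pose h := star z * z; have hp : cpos h := cpos_starM z.
have sh := cpos_star hp.
(* With [h] the square of the modulus of [z], [w] inverts the modulus on its support and is 0
   elsewhere, as the inverse of 0 is 0. The support projection is [q], and the partial isometry will
   be [z * w]. *)
pose w := fcalc h (fun l => (sqrtC l)^-1).
pose q := fcalc h (fun l => (l != 0)%:R).
pose r := fcalc h (fun l => sqrtC (sqrtC l)).
have sr : star r = r.
  apply: fcalc_star_real => // l /(spec_ge0 hp) l0.
  by rewrite ger0_real// !sqrtC_ge0.
have sw : star w = w.
  apply: fcalc_star_real => // l /(spec_ge0 hp) l0.
  by rewrite ger0_real// invr_ge0 sqrtC_ge0.
have sq : star q = q by apply: fcalc_star_real => // l _; rewrite realn.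
have rr : r * r = fcalc h sqrtC.
  by rewrite fcalcM//; apply: eq_fcalc => // l _; rewrite -expr2 sqrtCK.
(* The square of the modulus of [z * (1 - q)] is [(1 - q) * h * (1 - q)], which is 0, so
   faithfulness applies. *)
have zq : z * q = z.
  apply/eqP; rewrite eq_sym -subr_eq0 -[X in X - _]mulr1 -mulrBr.
  apply/eqP/trace_eq0; rewrite starM mulrA -[_ * z]mulrA -/h starB star1 sq.
  have -> : 1 - q = fcalc h (fun l => (l == 0)%:R).
    have -> : 1 = fcalc h (fun=> 1) by rewrite fcalc_cst// scale1r.
    rewrite -[fcalc h (fun l => (l == 0)%:R)](addrK q) fcalcD//; congr (_ - _).
    by apply: eq_fcalc => // l _; case: eqP; rewrite ?addr0 ?add0r.
  rewrite -{2}[h]fcalc_id// !fcalcM// -[RHS](linear0 t); congr (t _).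
  rewrite -[RHS](scale0r 1) -(fcalc_cst sh); apply: eq_fcalc => // l _.
  by case: eqP => [->|]; rewrite ?mulr0 ?mul0r.
exists (z * w), r; split => //.
- rewrite rr -mulrA fcalcM// -[RHS]zq; congr (_ * _).
  apply: eq_fcalc => // l _; have [->|l0] := eqVneq l 0.
    by rewrite sqrtC0 mulr0.
  by rewrite mulVf ?sqrtC_eq0.
- rewrite starM sw -mulrA -/h -[X in _ * X]fcalc_id// fcalcM// rr.
  apply: eq_fcalc => // l _; have [->|l0] := eqVneq l 0.
    by rewrite sqrtC0 mulr0.
  by rewrite -{2}[l]sqrtCK expr2 mulKf ?sqrtC_eq0.
(* For [u = z * w], [star u * u] equals [w * h * w], a projection. *)
- rewrite -(@ler_pXn2r _ 2)// ?nnegrE ?cnorm_ge0// expr1n -cnorm_cstar.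
  rewrite starM sw mulrA -[_ * z]mulrA -/h.
  rewrite -[X in _ * X * _]fcalc_id// !fcalcM//.
  apply: proj_cnorm_le1; split.
    rewrite fcalcM//; apply: eq_fcalc => // l _; have [->|l0] := eqVneq l 0.
      by rewrite !(mulr0, mul0r).
    suff -> : (sqrtC l)^-1 * l * (sqrtC l)^-1 = 1 by rewrite mulr1.
    by rewrite -{2}[l]sqrtCK expr2 mulKf ?divff ?sqrtC_eq0.
  apply: fcalc_star_real => // l /(spec_ge0 hp) l0.
  by rewrite ger0_real// !mulr_ge0 ?invr_ge0 ?sqrtC_ge0.
- rewrite rr /norm1 csqrt_fcalc// ge0_RRe// trace_ge0//.
  by case: (fcalc_sqrtP hp).
Qed.

Lemma norm1_ge0 z : 0 <= norm1 t z.
Proof.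
have [u [r [sr _ _ _ e]]] := polar z.
by rewrite -ler0c -e trace_ge0// -{1}sr; exists r.
Qed.

(** In the polar form [z = u * (r * r)], the trace of [star (r - u * r) * (r - u * r)] is twice the
    difference of the 1-norm and the real part of [t z]. The hypothesis makes it vanish, so
    [r = u * r] and [z = r * r]. *)
Lemma norm1_le_Re_cpos z : norm1 t z <= complex.Re (t z) -> cpos z.
Proof.
move=> le; have [u [r [sr uz suz _ e]]] := polar z.
have : t (star (r - u * r) * (r - u * r)) = 0.
  have ge : 0 <= t (star (r - u * r) * (r - u * r)).
    exact/trace_ge0/cpos_starM.
  apply/eqP; rewrite eq_le ge andbT.
  have -> : t (star (r - u * r) * (r - u * r)) =
     (norm1 t z)%:C%C + (norm1 t z)%:C%C - t z - (t z)^*.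
    have -> : star (r - u * r) * (r - u * r) =
       r * r + r * (star u * (u * r)) - r * (u * r) - r * (star u * r).
      rewrite starB starM sr mulrBl !mulrBr opprB -!mulrA.
      by rewrite addrACA addrA.
    rewrite !linearB linearD /= -!e; congr (_ + _ - _ - _).
    + by rewrite traceC -!mulrA uz suz.
    + by rewrite traceC -mulrA uz.
    + by rewrite -trace_star -[z]uz !starM sr [LHS]traceC [RHS]traceC -mulrA.
  rewrite -addrA -opprD addcJ -mulr2n -[_%:C%C *+ 2]mulr_natl -mulrBr.
  by rewrite pmulr_rle0 ?ltr0n// subr_le0 lecR.
move/trace_eq0/subr0_eq => e1; exists r.
by rewrite sr -uz mulrA -e1.
Qed.

(** The spectrum of [star x * x] is bounded by [M], the square of the norm of [x], so
    [M - star x * x] has the form [star k * k]; the trace of [star (k * y) * (k * y)] is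
    nonnegative. *)
Lemma trace_cnorm_le x y : complex.Re (t (star (x * y) * (x * y))) <=
  cnorm x ^+ 2 * complex.Re (t (star y * y)).
Proof.
pose h := star x * x; have hp : cpos h := cpos_starM x.
have sh := cpos_star hp; pose M : C := (cnorm x ^+ 2)%:C%C.
have /fcalc_cpos : forall l, l \in spec h -> 0 <= M - l.
  move=> l ls; have l0 := spec_ge0 hp ls.
  rewrite subr_ge0 -[l]ge0_RRe// lecR -cnorm_cstar.
  by have := eigenval_norm (spec_eigenval sh ls); rewrite ger0_norm.
move=> /(_ sh) [k hk].
have : 0 <= t (star (k * y) * (k * y)) by apply/trace_ge0/cpos_starM.
have -> : star (k * y) * (k * y) = M *: (star y * y) - star (x * y) * (x * y).
  have -> : star (k * y) * (k * y) = star y * (star k * k) * y.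
    by rewrite starM !mulrA.
  have -> : star (x * y) * (x * y) = star y * h * y by rewrite starM !mulrA.
  rewrite -hk; have -> : fcalc h (fun l => M - l) = M%:A - h.
    rewrite -(fcalc_cst sh) -[X in _ - X](fcalc_id sh).
    apply/eqP; rewrite eq_sym subr_eq fcalcD//; apply/eqP/eq_fcalc => // l _.
    by rewrite subrK.
  by rewrite mulrBr mulrBl -scalerAr mulr1 -scalerAl.
rewrite linearB linearZ /= subr_ge0 lecE => /andP[_].
by rewrite Re_realM.
Qed.

(** With [z = u * (r * r)], [b = w * u] and [K] the norm of [w], expand the nonnegative trace of
    [star (b * r - K r) * (b * r - K r)]. Its cross terms give twice [K] times the left side, and
    [trace_cnorm_le] bounds the term quadratic in [b]. *)
Lemma holder w z : complex.Re (t (w * z)) <= cnorm w * norm1 t z.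
Proof.
have [u [r [sr uz suz u1 e]]] := polar z.
have [->|/cnorm_gt0 w0] := eqVneq w 0.
  by rewrite mul0r linear0 cnorm0 mul0r.
pose b := w * u; pose K := cnorm w.
have bK : cnorm b <= K.
  by apply: (le_trans (cnormM _ _)); rewrite ler_piMr ?cnorm_ge0.
pose N := norm1 t z; have N0 : 0 <= N := norm1_ge0 z.
have tb : t (star (b * r) * r) = (t (w * z))^*.
  by rewrite -trace_star -[z]uz [w * _]mulrA -/b !starM sr [LHS]traceC !mulrA.
have tb' : t (r * (b * r)) = t (w * z).
  by rewrite traceC /b -!mulrA uz.
pose x := b * r - K%:C%C *: r.
have : 0 <= complex.Re (t (star x * x)).
  by have := trace_ge0 (cpos_starM x); rewrite lecE => /andP[].
have -> : t (star x * x) = t (star (b * r) * (b * r)) - K%:C%C * t (w * z)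
    - K%:C%C * (t (w * z))^* + K%:C%C ^+ 2 * N%:C%C.
  rewrite /x starB starZ_real ?ler0c ?cnorm_ge0// sr mulrBl !mulrBr.
  rewrite -!scalerAl -!scalerAr scalerA -expr2.
  rewrite !(linearB t) !(linearZ_LR t) /= tb tb' e.
  by rewrite opprB addrA addrAC; congr (_ + _); rewrite addrAC.
have := trace_cnorm_le b r; rewrite sr e /= => le1.
have {}le1 : complex.Re (t (star (b * r) * (b * r))) <= K ^+ 2 * N.
  by apply: (le_trans le1); rewrite ler_wpM2r// ler_pXn2r// nnegrE cnorm_ge0.
rewrite -rmorphXn !raddfD /= !raddfN /= !Re_realM Re_conj mulr0 subr0 => H.
have : K * complex.Re (t (w * z)) *+ 2 <= K ^+ 2 * N *+ 2 by lra.
by rewrite lerMn2r/= expr2 -mulrA ler_pM2l.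
Qed.

Lemma cnorm1_le1 : cnorm (1 : A) <= 1.
Proof. by apply: proj_cnorm_le1; split; rewrite ?mulr1 ?star1. Qed.

(* [2 h = u + star u] with [u = h + i sqrt (M^2 - h^2)], and [star u * u] is
   the scalar [M^2], so that [u] has norm at most [M]. *)
Lemma spec_cnorm_le h (M : R) : star h = h -> 0 <= M ->
  (forall l, l \in spec h -> `|l| <= M%:C%C) -> cnorm h <= M.
Proof.
move=> sh M0 hM.
pose g l := sqrtC ((M%:C%C) ^+ 2 - l ^+ 2).
have gr l : l \in spec h -> (g l)^* = g l.
  move=> ls; rewrite geC0_conj// sqrtC_ge0 subr_ge0 -[l ^+ 2]real_normK.
    by rewrite ler_pXn2r ?nnegrE ?normr_ge0 ?ler0c//; apply: hM.
  by apply/CrealP; apply: (spec_real sh).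
pose u := fcalc h (fun l => l + 'i * g l).
have su : star u = fcalc h (fun l => l - 'i * g l).
  rewrite fcalc_star//; apply: eq_fcalc => // l ls.
  by rewrite rmorphD rmorphM /= conjCi gr// (spec_real sh ls) mulNr.
have uM : cnorm u <= M.
  rewrite -(@ler_pXn2r _ 2)// ?nnegrE ?cnorm_ge0// -cnorm_cstar su fcalcM//.
  rewrite (@eq_fcalc _ sh _ (fun=> M%:C%C ^+ 2)).
    rewrite fcalc_cst// cnormZ ger0_norm ?exprn_ge0 ?ler0c// -rmorphXn /=.
    by rewrite ler_piMr ?exprn_ge0 ?cnorm1_le1.
  move=> l ls; rewrite -subr_sqr exprMn sqrCi sqrtCK mulN1r opprK.
  by rewrite addrC subrK.
have : cnorm (2%:R *: h) <= M *+ 2.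
  have -> : 2%:R *: h = u + star u.
    rewrite scaler_nat mulr2n -[h in LHS]fcalc_id// su !fcalcD//.
    by apply: eq_fcalc => // l _; rewrite addrACA subrr addr0.
  by rewrite (le_trans (cnormD _ _))// cnorm_star mulr2n lerD.
rewrite cnormZ normr_nat.
have -> : complex.Re (2%:R : C) = 2%:R by rewrite raddfMn.
by rewrite mulr_natl lerMn2r.
Qed.

(** For an eigenvalue [l] of [star z * z] with spectral projection [q], test the hypothesis on
    [w = z * q]. The left side is [l * t q] and the 1-norm of [w] is [sqrtC l * t q], whence
    [sqrtC l <= K]. *)
Lemma cnorm_le_dual z (K : R) : 0 <= K ->
  (forall w, complex.Re (t (star w * z)) <= K * norm1 t w) -> cnorm z <= K.
Proof.
move=> K0 H; pose h := star z * z; have hp : cpos h := cpos_starM z.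
have sh := cpos_star hp.
rewrite -(@ler_pXn2r _ 2)// ?nnegrE ?cnorm_ge0// -cnorm_cstar.
apply: spec_cnorm_le => //; first by rewrite exprn_ge0.
move=> l ls; have l0 := spec_ge0 hp ls.
have s0 : 0 <= sqrtC l by rewrite sqrtC_ge0.
pose q := fcalc h (fun m => (m == l)%:R).
have sq : star q = q by apply: fcalc_star_real => // m _; rewrite realn.
have qq : q * q = q.
  by rewrite fcalcM//; apply: eq_fcalc => // m _; rewrite -natrM mulnb andbb.
have qh : q * h = l *: q.
  rewrite -[X in _ * X](fcalc_id sh) -mulr_algl -(fcalc_cst sh) !fcalcM//.
  apply: eq_fcalc => // m _.
  by case: eqP => [->|]; rewrite ?mulr1 ?mul1r ?mul0r ?mulr0.
have q0 : q != 0.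
  apply/eqP => q0; have := fcalc_eq0 sh q0 ls.
  by rewrite eqxx => /eqP; rewrite oner_eq0.
have tq : 0 < t q by rewrite -qq -{1}sq trace_gt0.
have qp : cpos q by rewrite -qq -{1}sq; apply: cpos_starM.
have := H (z * q); rewrite starM sq -mulrA -/h qh linearZ /=.
rewrite /norm1 starM sq.
have -> : csqrt (q * star z * (z * q)) = sqrtC l *: q.
  apply: csqrt_unique; first exact: cposZ.
  rewrite -scalerAl -scalerAr scalerA -expr2 sqrtCK qq.
  by rewrite -mulrA [star z * _]mulrA -/h mulrA qh -scalerAl qq.
rewrite linearZ /= -{1}[l]sqrtCK -[sqrtC l]ge0_RRe// -rmorphXn !Re_realM.
set s := complex.Re (sqrtC l); set T := complex.Re (t q).
have T0 : 0 < T by move: tq; rewrite ltcE => /andP[].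
have s0' : 0 <= s by rewrite -ler0c ge0_RRe.
rewrite mulrA ler_pM2r// expr2 => sK.
rewrite ger0_norm// -[l]sqrtCK -[sqrtC l]ge0_RRe// -rmorphXn lecR -/s.
rewrite ler_pXn2r ?nnegrE//.
by move: s0'; rewrite le_eqVlt => /predU1P[<-//|sp]; rewrite -(ler_pM2r sp).
Qed.

End Spectrum.

(** * Fusion bialgebras *)

(** For positive [h], the spectral projections sum to 1, so some [q] among them has [p * q != 0]. By
    commutativity [p * q] is a projection below [p], so minimality gives [p * q = p], and [h] acts
    on [p] by the eigenvalue of [q]. *)
Lemma minimal_proj_char (R : realType) (A : fdCStarType R) (d : {scalar A})
    (p : A) :
  faithful_trace d -> (forall x y : A, x * y = y * x) -> minimal_proj p ->
  forall x, exists a : R[i], p * x = a *: p.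
Proof.
move=> fd mC [[pp sp] p0 pmin].
elim/cpos_span => [x y [a xa] [b yb]|a x [b xb]|h hp].
- by exists (a + b); rewrite mulrDr xa yb scalerDl.
- by exists (a * b); rewrite -scalerAr xb scalerA.
have sh := cpos_star hp.
have [[l pl]|no] := pselect (exists l, p * fcalc h (fun m => (m == l)%:R) != 0).
  exists l; set q := fcalc h _ in pl.
  have sq : star q = q by apply: (fcalc_star_real fd) => // m _; rewrite realn.
  have qq : q * q = q.
    rewrite (fcalcM fd)//; apply: (eq_fcalc fd) => // m _.
    by rewrite -natrM mulnb andbb.
  have pqp : p * q * (p * q) = p * q.
    by rewrite mulrA -[p * q * p]mulrA [q * p]mC mulrA pp -mulrA qq.
  have spq : star (p * q) = p * q by rewrite starM sp sq mC.
  have hq : q * h = l *: q.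
    rewrite -[X in _ * X](fcalc_id fd sh) -mulr_algl -(fcalc_cst fd sh).
    rewrite !(fcalcM fd)//; apply: (eq_fcalc fd) => // m _.
    by case: eqP => [->|]; rewrite ?mulr1 ?mul1r ?mul0r ?mulr0.
  have ppq : cpos (p - p * q).
    exists (p - p * q); rewrite starB sp spq mulrBl !mulrBr pp pqp.
    by rewrite mulrA pp -mulrA [q * p]mC mulrA pp subrr subr0.
  have [/eqP|pq] := pmin _ (conj pqp spq) ppq; first by rewrite (negPf pl).
  by rewrite -pq -mulrA hq -scalerAr.
case/eqP: p0; rewrite -[LHS]mulr1 -(fcalc_delta_sum fd sh) mulr_sumr.
rewrite big1// => l _.
by apply: contrapT => /eqP pl; apply: no; exists l.
Qed.

Section FusionBialgebra.
Variables (R : realType) (A B : fdCStarType R) (F : 'Hom(A, B)).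
Variables (d : {scalar A}) (tau : {scalar B}).
Hypothesis fus : fusion_bialgebra F d tau.
Hypothesis d_unit : d ((F^-1)%VF 1) = 1.
Local Notation Fi := (F^-1)%VF.
Local Notation e := (Fi 1).
Implicit Types (a b c : A) (x y z w : B).

Let ftau := fb_tau fus.

Lemma fusionK : cancel F Fi.
Proof. by apply: lker0_lfunK; apply/lker0P/bij_inj/(fb_bij fus). Qed.

Lemma fusionVK : cancel Fi F.
Proof. by case: (fb_bij fus) => g _ gK x; rewrite -[x]gK fusionK. Qed.

Lemma dual_convE x y : dual_conv F x y = F (Fi x * Fi y).
Proof.
have J z : Fi (star z) = modconj F (Fi z) by rewrite /modconj fusionVK.
rewrite /dual_conv !J -(fb_modconjM fus) /modconj fusionVK starK.
by rewrite (fb_mulC fus).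
Qed.

(** Both sides are additive and conjugate-homogeneous in each argument, so positive [a] and [b]
    suffice; there the Schur product axiom makes the convolution selfadjoint. *)
Lemma conv_star a b : star (conv F a b) = conv F (star a) (star b).
Proof.
rewrite /conv; elim/cpos_span : a => [a a' IHa IHa'|k a IHa|a ap].
- by rewrite starD !linearD !mulrDl !linearD /= starD IHa IHa'.
- by rewrite starZ !linearZ -!scalerAl !linearZ /= starZ IHa.
elim/cpos_span : b => [b b' IHb IHb'|k b IHb|b bp].
- by rewrite starD !linearD !mulrDr !linearD /= starD IHb IHb'.
- by rewrite starZ !linearZ -!scalerAr !linearZ /= starZ IHb.
by rewrite (cpos_star (fb_schur fus ap bp)) !cpos_star.
Qed.

(** * The conjugation [sigma] of [B] induced by the involution of [A] *)

Definition dual_modconj x : B := F (star (Fi x)).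

Lemma dual_modconjM x y :
  dual_modconj (x * y) = dual_modconj x * dual_modconj y.
Proof.
have := conv_star (Fi x) (Fi y); rewrite /conv !fusionVK => h.
by rewrite /dual_modconj h fusionVK.
Qed.

Lemma dual_modconj_star x : dual_modconj (star x) = star (dual_modconj x).
Proof.
have J : Fi (star x) = modconj F (Fi x) by rewrite /modconj fusionVK.
by rewrite /dual_modconj J -(fb_modconjJ fus) /modconj fusionVK.
Qed.

Lemma dual_modconj_cpos x : cpos x -> cpos (dual_modconj x).
Proof.
by case=> y ->; exists (dual_modconj y); rewrite dual_modconjM
  dual_modconj_star.
Qed.

Lemma star_unit : star e = e.
Proof.
have [k [p [k0 [[_ sp] _ _] ->]]] := fb_jones fus.
by rewrite starZ_real ?ltW// sp.
Qed.

Lemma tau_fusion a : tau (F a) = d (e * a).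
Proof. by rewrite -star_unit -(fb_unitary fus) fusionVK star1 mul1r. Qed.

(** As [e] is a multiple of a minimal projection, [e * a] is a multiple of [e]; applying [d] and the
    normalization [d e = 1] identifies the scalar. *)
Lemma unit_char a : e * a = tau (F a) *: e.
Proof.
have [k [p [k0 pmin ep]]] := fb_jones fus.
have [l pa] := minimal_proj_char (fb_d fus) (fb_mulC fus) pmin a.
have ea : e * a = l *: e by rewrite ep -scalerAl pa !scalerA mulrC.
by rewrite tau_fusion ea linearZ /= d_unit mulr1.
Qed.

Lemma tau_dual_conv x y : tau (dual_conv F x y) = tau x * tau y.
Proof.
rewrite dual_convE tau_fusion mulrA unit_char -scalerAl unit_char !fusionVK.
by rewrite !linearZ /= d_unit mulr1.
Qed.

Lemma tau_dual_modconj x : tau (dual_modconj x) = (tau x)^*.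
Proof.
rewrite tau_fusion -star_unit -starM (fb_mulC fus) unit_char fusionVK.
by rewrite starZ linearZ /= star_unit d_unit mulr1.
Qed.

(** Being multiplicative, star-preserving and positive, [dual_modconj] maps the modulus of [x] to
    that of its image; it changes the trace only by conjugation. *)
Lemma norm1_dual_modconj x : norm1 tau (dual_modconj x) = norm1 tau x.
Proof.
have [sp ss] := csqrtP ftau (cpos_starM x).
rewrite /norm1 -dual_modconj_star -dual_modconjM.
rewrite (csqrt_unique ftau (dual_modconj_cpos sp)).
  by rewrite tau_dual_modconj Re_conj.
by rewrite -dual_modconjM ss.
Qed.

(* Frobenius reciprocity: convolution by [dual_modconj x] is the adjoint of
   convolution by [x]. *)
Lemma dual_conv_adjoint x y w : tau (star w * dual_conv F x y) =
  tau (star (dual_conv F (dual_modconj x) w) * y).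
Proof.
rewrite !dual_convE /dual_modconj fusionK -{1}[w]fusionVK -{2}[y]fusionVK.
by rewrite !(fb_unitary fus) starM starK mulrA.
Qed.

Lemma cpos_of_norm1_le x y : cpos x -> cpos y ->
  norm1 tau (dual_conv F x y) <= norm1 tau x * norm1 tau y ->
  cpos (dual_conv F x y).
Proof.
move=> xp yp le; apply: (norm1_le_Re_cpos ftau); rewrite tau_dual_conv.
by rewrite (norm1_cpos ftau xp) (norm1_cpos ftau yp) Re_realM.
Qed.

End FusionBialgebra.

(** The hypothesis [d_unit] is the usual normalization: for another value of [d ((F^-1)%VF 1)],
    [tau] is multiplicative for the dual convolution only up to the inverse of that value. *)
Theorem proposition5p8 (R : realType) (A B : fdCStarType R) (F : 'Hom(A, B))
    (d : {scalar A}) (tau : {scalar B})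
    (fusAB : fusion_bialgebra F d tau)
    (d_unit : d ((F^-1)%VF 1) = 1) :
  let S1 := forall x y : B, cpos x -> cpos y -> cpos (dual_conv F x y) in
  let S2 := forall x y : B, cpos x -> cpos y ->
    norm1 tau (dual_conv F x y) = norm1 tau x * norm1 tau y in
  let S3 := forall x y : B,
    norm1 tau (dual_conv F x y) <= norm1 tau x * norm1 tau y in
  let S4 := forall x y : B,
    cnorm (dual_conv F x y) <= norm1 tau x * cnorm y in
  [/\ S4 <-> S3, S3 -> S1 & S1 <-> S2].
Proof.
have ftau := fb_tau fusAB; split.
- split=> H x y.
    (* [S4 -> S3]: the 1-norm of [z] is attained by pairing with the polar part [u]. Adjointness
       moves [x] onto [u], and [S4] bounds the C*-norm of that convolution since [u] has norm at
       most 1. *)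
    set z := dual_conv F x y; have [u [r [_ _ uz u1 e]]] := polar ftau z.
    have -> : norm1 tau z = complex.Re (tau (star u * z)) by rewrite uz e.
    rewrite (dual_conv_adjoint fusAB); apply: (le_trans (holder ftau _ _)).
    rewrite cnorm_star ler_wpM2r ?norm1_ge0//; apply: (le_trans (H _ _)).
    by rewrite (norm1_dual_modconj fusAB d_unit) ler_piMr ?norm1_ge0.
  (* [S3 -> S4]: pair with an arbitrary [w], move [x] onto [w] by adjointness, and bound the 1-norm
     of that convolution by [S3]. *)
  apply: (cnorm_le_dual ftau) => [|w].
    by rewrite mulr_ge0 ?norm1_ge0 ?cnorm_ge0.
  rewrite (dual_conv_adjoint fusAB); set v := dual_conv F _ w.
  have -> : star v * y = star (star y * v) by rewrite starM starK.
  rewrite (trace_star ftau) Re_conj; apply: (le_trans (holder ftau _ _)).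
  rewrite cnorm_star [leRHS]mulrAC [leRHS]mulrC ler_wpM2l ?cnorm_ge0//.
  by rewrite -(norm1_dual_modconj fusAB d_unit x); apply: H.
- by move=> S3 x y xp yp; apply: (cpos_of_norm1_le fusAB d_unit).
- split=> H x y xp yp; last first.
    by apply: (cpos_of_norm1_le fusAB d_unit) => //; rewrite H.
  (* Under [S1] the convolution is positive too, so all three 1-norms are traces and
     multiplicativity of [tau] is the claim. *)
  have := tau_dual_conv fusAB d_unit x y.
  rewrite (norm1_cpos ftau (H _ _ xp yp)) (norm1_cpos ftau xp).
  by rewrite (norm1_cpos ftau yp) -rmorphM => /complexI.
Qed.
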